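(* Let $G=(V,E)$ be an almost complete graph with $n\ge4$ vertices and let $I$ be its cover ideal. Then $I$ is a quasi-equigenerated Freiman ideal of linear type.
   Context: All graphs are finite and simple; vertices are identified with variables of a polynomial ring over a field $k$. A graph with $N$ vertices is almost complete if it has an induced complete subgraph on $N-1$ vertices. For a graph $G$ with vertices $x_1,\dots,x_n$ and edge set $E$, the cover ideal is $J(G)=\bigcap_{\{x_i,x_j\}\in E}(x_i,x_j)\subseteq R=k[x_1,\dots,x_n]$. A monomial ideal $I\subseteq R$ with minimal monomial generators $f_1,\dots,f_t$, $f_j=\prod_{i=1}^n x_i^{c_{ij}}$, is quasi-equigenerated if there is $\alpha=(a_1,\dots,a_n)$ with all $a_i$ positive integers such that $\sum_{i=1}^n a_i c_{ij}$ is the same for all $j$. The fiber cone is $F(I)=\bigoplus_{i\ge0}I^i/\mathfrak m I^i$ with $\mathfrak m=(x_1,\dots,x_n)$; the analytic spread $l(I)$ is the Krull dimension of $F(I)$; $\mu(\cdot)$ is the minimal number of generators. $I$ is of linear type (in this paper's terminology) if $F(I)$ is isomorphic to a polynomial ring over $k$ in $\mu(I)$ variables. A quasi-equigenerated monomial ideal $I$ is a Freiman ideal if $\mu(I^2)=l(I)\mu(I)-\binom{l(I)}{2}$. *)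

(* Defs.v *)
From HB Require Import structures.
From mathcomp Require Import all_boot all_order all_algebra.
From mathcomp Require Import boolp mpoly.

Set Implicit Arguments.
Unset Strict Implicit.
Unset Printing Implicit Defensive.

Import GRing.Theory.
Local Open Scope ring_scope.

(* Ideals of a commutative ring are represented by their membership
   predicates; undecidable conditions are turned into booleans with asbool. *)
Section Ideals.
Variable R : comNzRingType.
Implicit Types I J K L : {pred R}.

Definition ideal_gen (s : seq R) : {pred R} := fun f =>
  `[< exists c : 'I_(size s) -> R, f = \sum_(i < size s) c i * s`_i >].

Definition ideal_mul I J : {pred R} := fun f =>
  `[< exists2 s : seq (R * R),
        forall p, p \in s -> p.1 \in I /\ p.2 \in J
      & f = \sum_(p <- s) p.1 * p.2 >].

Fixpoint ideal_pow I (i : nat) : {pred R} :=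
  if i is j.+1 then ideal_mul I (ideal_pow I j) else predT.

(* mu(I) = m *)
Definition min_num_gens I (m : nat) : Prop :=
  (exists2 s : seq R, size s = m & I =i ideal_gen s) /\
  (forall s : seq R, I =i ideal_gen s -> (m <= size s)%N).

(* idealr_closed includes properness. *)
Definition is_prime_ideal I : Prop := idealr_closed I /\ prime_idealr_closed I.

(* Only the values P 0, ..., P d matter. *)
Definition prime_chain (P : nat -> {pred R}) (d : nat) : Prop :=
  (forall i, (i <= d)%N -> is_prime_ideal (P i)) /\
  (forall i, (i < d)%N ->
     {subset P i <= P i.+1} /\ ~ {subset P i.+1 <= P i}).

Definition has_krull_dim (d : nat) : Prop :=
  (exists P, prime_chain P d) /\
  (forall P d', prime_chain P d' -> (d' <= d)%N).

Definition ideal_stable I : Prop :=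
  [/\ 0 \in I, {in I &, forall f g, f + g \in I}
    & forall a, {in I, forall f, a * f \in I}].

Lemma ideal_gen_stable s : ideal_stable (ideal_gen s).
Proof.
split.
- apply/asboolP; exists (fun=> 0).
  by rewrite big1 // => i _; rewrite mul0r.
- move=> f g /asboolP[c ->] /asboolP[d ->]; apply/asboolP.
  exists (fun i => c i + d i); rewrite -big_split /=.
  by apply: eq_bigr => i _; rewrite mulrDl.
- move=> a f /asboolP[c ->]; apply/asboolP; exists (fun i => a * c i).
  by rewrite mulr_sumr; apply: eq_bigr => i _; rewrite mulrA.
Qed.

Lemma ideal_mul_stable I J :
  (forall a, {in J, forall f, a * f \in J}) -> ideal_stable (ideal_mul I J).
Proof.
move=> Jm; split.
- by apply/asboolP; exists [::]; rewrite ?big_nil.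
- move=> f g /asboolP[s sP ->] /asboolP[t tP ->]; apply/asboolP.
  exists (s ++ t); last by rewrite big_cat.
  by move=> p; rewrite mem_cat => /orP[/sP|/tP].
- move=> a f /asboolP[s sP ->]; apply/asboolP.
  exists [seq (p.1, a * p.2) | p <- s].
    by move=> _ /mapP[p /sP[p1 p2] ->]; split=> //; apply: Jm.
  by rewrite big_map mulr_sumr; apply: eq_bigr => p _; rewrite mulrCA.
Qed.

Lemma ideal_pow_stable I i : ideal_stable (ideal_pow I i).
Proof.
by elim: i => [//|i [_ _ IH]]; apply: ideal_mul_stable.
Qed.

Lemma ideal_mul_in I J f g : f \in I -> g \in J -> f * g \in ideal_mul I J.
Proof.
move=> fI gJ; apply/asboolP; exists [:: (f, g)]; last by rewrite big_seq1.
by move=> p; rewrite inE => /eqP ->.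
Qed.

Lemma ideal_sum I (T : Type) (r : seq T) (P : pred T) (F : T -> R) :
  ideal_stable I -> (forall i, P i -> F i \in I) ->
  \sum_(i <- r | P i) F i \in I.
Proof. by case=> I0 ID _ FI; elim/big_ind: _ => // x y; apply: ID. Qed.

Lemma ideal_mulA_in I J K L f g :
  ideal_stable L -> f \in ideal_mul I J -> g \in K ->
  (forall x y, x \in J -> y \in K -> forall z, z \in I -> z * (x * y) \in L) ->
  f * g \in L.
Proof.
move=> Ls /asboolP[s sP ->] gK H; rewrite mulr_suml big_seq.
by apply: ideal_sum => // p /sP[p1 p2]; rewrite -mulrA; apply: H.
Qed.

Lemma ideal_powD I i j f g :
  f \in ideal_pow I i -> g \in ideal_pow I j -> f * g \in ideal_pow I (i + j).
Proof.
elim: i f g => [|i IH] f g fI gI.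
  by have [_ _ IM] := ideal_pow_stable I j; apply: IM.
apply: (ideal_mulA_in (ideal_pow_stable I _) fI gI) => x y xI yI z zI.
by apply: ideal_mul_in => //; apply: IH.
Qed.

End Ideals.

Section MonomialIdeals.
Variables (k : fieldType) (n : nat).
Implicit Type I : {pred {mpoly k[n]}}.

Definition monomial_ideal_gen (s : seq 'X_{1..n}) : {pred {mpoly k[n]}} :=
  ideal_gen [seq 'X_[m] | m <- s].

Definition min_monomial_gens I (s : seq 'X_{1..n}) : Prop :=
  I =i monomial_ideal_gen s /\
  (forall m, m \in s -> ~ (I =i monomial_ideal_gen (rem m s))).

Definition quasi_equigenerated I : Prop :=
  exists s : seq 'X_{1..n}, min_monomial_gens I s /\
  exists a : 'I_n -> nat, (forall i, 0 < a i)%N /\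
  exists d : nat, forall m, m \in s -> (\sum_(i < n) a i * m i)%N = d.

Definition max_ideal : {pred {mpoly k[n]}} :=
  ideal_gen [seq 'X_i | i <- enum 'I_n].

End MonomialIdeals.

Arguments max_ideal : clear implicits.

(* The fiber cone F(I), the direct sum of the I^i / m I^i, is constructed as
   the quotient of the Rees algebra R[It] = {\sum_i f_i t^i | f_i \in I^i},
   a subring of R[t], by {\sum_i f_i t^i | f_i \in m I^i}. *)
Section FiberCone.
Variables (k : fieldType) (n : nat) (I : {pred {mpoly k[n]}}).

Definition rees_pred : {pred {poly {mpoly k[n]}}} := fun p =>
  `[< forall i, p`_i \in ideal_pow I i >].

Lemma rees_pred_subring : subring_closed rees_pred.
Proof.
split.
- apply/asboolP => i; rewrite coef1; case: i => [//|i] /=.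
  by have [] := ideal_pow_stable I i.+1.
- move=> p q /asboolP pI /asboolP qI; apply/asboolP => i.
  have [_ ID IM] := ideal_pow_stable I i.
  by rewrite coefB -mulN1r; apply: ID => //; apply: IM.
- move=> p q /asboolP pI /asboolP qI; apply/asboolP => i.
  rewrite coefM; apply: ideal_sum => [|j _]; first exact: ideal_pow_stable.
  by have := ideal_powD (pI j) (qI (i - j)%N); rewrite subnKC // -ltnS.
Qed.

HB.instance Definition _ :=
  GRing.isSubringClosed.Build {poly {mpoly k[n]}} rees_pred rees_pred_subring.

Record rees := Rees { rees_val :> {poly {mpoly k[n]}};
                      rees_valP : rees_val \in rees_pred }.

HB.instance Definition _ := [isSub for rees_val].
HB.instance Definition _ := [Choice of rees by <:].
HB.instance Definition _ := [SubChoice_isSubComNzRing of rees by <:].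

Definition rees_max : {pred rees} := fun p =>
  `[< forall i, (val p)`_i \in ideal_mul (max_ideal k n) (ideal_pow I i) >].

Lemma rees_max_idealr : idealr_closed rees_max.
Proof.
have Ms i : ideal_stable (ideal_mul (max_ideal k n) (ideal_pow I i)).
  by apply: ideal_mul_stable; have [] := ideal_pow_stable I i.
split.
- by apply/asboolP => i; rewrite rmorph0 coef0;
    have [] := Ms i.
- apply/asboolP => /(_ 0%N); rewrite rmorph1 coef1 /=.
  move=> /asboolP[s sP] /(congr1 (fun p : {mpoly k[n]} => p@_0)) /eqP.
  rewrite mcoeff1 eqxx raddf_sum /= big_seq big1 ?oner_eq0 // => p /sP[p1 _].
  move/asboolP: p1 => [c ->].
  rewrite rmorphM /= raddf_sum /= big1 ?mul0r // => i _.
  rewrite rmorphM /= [X in _ * X](_ : _ = 0) ?mulr0 //.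
  have: [seq 'X_i | i <- enum 'I_n]`_i
          \in [seq ('X_i : {mpoly k[n]}) | i <- enum 'I_n] by rewrite mem_nth.
  by move=> /mapP[j _ ->]; rewrite mcoeffX mnm1_eq0.
- move=> a p q /asboolP pM /asboolP qM; apply/asboolP => i.
  rewrite rmorphD rmorphM coefD.
  have [_ MD _] := Ms i; apply: MD => //; rewrite coefM.
  apply: ideal_sum => // j _; rewrite mulrC.
  have /asboolP aI := rees_valP a.
  apply: (ideal_mulA_in (Ms i) (pM _) (aI _)) => x y xI yI z zM.
  apply: ideal_mul_in => //.
  by have := ideal_powD xI yI; rewrite subnK // -ltnS.
Qed.

HB.instance Definition _ := isIdealr.Build rees rees_max rees_max_idealr.

Definition fiber_cone : comNzRingType := {ideal_quot rees_max}.

Lemma rees_const_subproof (c : k) : (c%:MP_[n])%:P \in rees_pred.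
Proof.
apply/asboolP => -[|i]; rewrite coefC //=.
by have [] := ideal_pow_stable I i.+1.
Qed.

(* The structure map k -> F(I). *)
Definition fiber_const (c : k) : fiber_cone :=
  (\pi_({ideal_quot rees_max}) (Rees (rees_const_subproof c)))%qT.

Definition analytic_spread_is (l : nat) : Prop := has_krull_dim fiber_cone l.

Definition linear_type : Prop :=
  exists2 m : nat, min_num_gens I m &
  exists2 phi : {rmorphism {mpoly k[m]} -> fiber_cone},
    bijective phi & forall c : k, phi c%:MP = fiber_const c.

Definition freiman : Prop :=
  quasi_equigenerated I /\
  exists l m m2 : nat,
    [/\ analytic_spread_is l, min_num_gens I m,
        min_num_gens (ideal_pow I 2) m2
      & m2%:Z = l%:Z * m%:Z - 'C(l, 2)%:Z].

End FiberCone.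

Section Graphs.
Variable n : nat.
Implicit Type e : rel 'I_n.

Definition simple_graph e : Prop := ssrbool.symmetric e /\ irreflexive e.

Definition almost_complete e : Prop :=
  exists2 S : {set 'I_n}, #|S| = n.-1 & {in S &, forall x y, x != y -> e x y}.

Definition cover_ideal (k : fieldType) e : {pred {mpoly k[n]}} := fun f =>
  [forall i, forall j, e i j ==> (f \in ideal_gen [:: 'X_i; 'X_j])].

End Graphs.

Arguments cover_ideal {n} k e _.

(* Main.v *)
(* In an almost complete graph any two vertices other than some [v] are
   adjacent, so a vertex cover misses at most one vertex besides [v].  The
   minimal generators of the cover ideal are thus the products of all variables
   but one when the graph is complete and, otherwise, the monomials
   [(\prod_(i != v, i != x) X_i) * X_v ^ (e v x)], [x != v].  Giving the
   variable [X_i] the weight 1 in the first case, and 2 or 1 in the second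
   according to whether [i] is adjacent to [v], makes all generators of equal
   weight [d].  Their exponent vectors are linearly independent, so the monomials
   of degree [i] in the generators are distinct; they all have weight [i * d],
   whereas the ideal [m I^i] lives in weights above [i * d].  Hence the fiber cone
   is a polynomial ring in [t = mu(I)] variables, [l(I) = t], and
   [mu(I^2) = C(t + 1, 2) = t * t - C(t, 2)].

   For the Krull dimension: choosing [x_i] in [P_(i+1)] outside [P_i] along a
   chain of primes of length [t + 1] makes the monomials in the [x_i]
   linearly independent modulo [P_0], and these are too many for the space of
   polynomials of bounded degree in [t] variables. *)
Require Import Defs.
From HB Require Import structures.
From mathcomp Require Import all_boot all_order all_algebra.
From mathcomp Require Import boolp mpoly.
Set Implicit Arguments.
Unset Strict Implicit.
Unset Printing Implicit Defensive.

(** * Prime chains and Krull dimension under ring isomorphism *)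

Section PrimeChains.
Local Open Scope ring_scope.
Import GRing.Theory.

(** Surjectivity is what keeps the inclusions strict after taking preimages. *)
Lemma prime_chain_preim (A B : comNzRingType) (phi : {rmorphism A -> B}) P d :
  (forall b, exists a, phi a = b) -> prime_chain P d ->
  prime_chain (fun i a => phi a \in P i) d.
Proof.
move=> phi_surj [Pprime Plt]; split=> i le_id.
  have [[P0 P1 Pl] Pm] := Pprime i le_id; split; first split.
  - by rewrite unfold_in rmorph0.
  - by rewrite unfold_in rmorph1.
  - by move=> a u v; rewrite !unfold_in rmorphD rmorphM; apply: Pl.
  - by move=> u v; rewrite !unfold_in rmorphM; apply: Pm.
have [PS nPS] := Plt i le_id; split=> [a|sub]; first exact: PS.
by apply: nPS => b; have [a <-] := phi_surj b; apply: sub.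
Qed.

Lemma has_krull_dim_iso (A B : comNzRingType) (phi : {rmorphism A -> B}) d :
  bijective phi -> has_krull_dim A d -> has_krull_dim B d.
Proof.
move=> [psi phiK psiK] [[P Pch] maxA].
pose psiZ := GRing.isZmodMorphism.Build B A psi (can2_zmod_morphism phiK psiK).
pose psiM := GRing.isMonoidMorphism.Build B A psi
  (can2_monoid_morphism phiK psiK).
pose psiR : {rmorphism B -> A} := HB.pack psi psiZ psiM.
split=> [|Q d' Qch].
  exists (fun i b => psiR b \in P i).
  by apply: prime_chain_preim Pch => a; exists (phi a); apply: phiK.
apply: (maxA (fun i a => phi a \in Q i)).
by apply: prime_chain_preim Qch => b; exists (psi b).
Qed.

End PrimeChains.

(** * Krull dimension of a polynomial ring over a field *)

Section KrullDimPolynomial.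
Local Open Scope ring_scope.
Import GRing.Theory.
Variables (k : fieldType) (m : nat).
Local Notation A := {mpoly k[m]}.
Implicit Types (P : {pred A}) (s t : seq A).

(** Coefficients are indexed by [nat] so that they can be shifted when families are concatenated;
    values from [size s] on are ignored. *)
Definition lin_indep_mod P s := forall c : nat -> k,
  \sum_(0 <= i < size s) c i *: s`_i \in P ->
  forall i, (i < size s)%N -> c i = 0.

Definition deg_below (L : nat) s := forall f, f \in s -> (msize f <= L)%N.

(** Modulo [P'] the multiples of [x] vanish, so a relation first kills the coefficients on [s]. What
    remains is [x * T] in [P]; as [P] is prime and misses [x], [T] is in [P], and independence of
    [t] finishes. *)
Lemma lin_indep_mod_cat P P' s t (x : A) :
  is_prime_ideal P -> is_prime_ideal P' -> {subset P <= P'} ->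
  x \in P' -> x \notin P -> lin_indep_mod P' s -> lin_indep_mod P t ->
  lin_indep_mod P (s ++ [seq x * b | b <- t]).
Proof.
move=> [[P0 _ Pl] Pm] [[P'0 _ P'l] _] PP' xP' xP s_indep t_indep c.
set T := \sum_(0 <= j < size t) c (size s + j)%N *: t`_j.
have -> : \sum_(0 <= i < size (s ++ [seq x * b | b <- t]))
    c i *: (s ++ [seq x * b | b <- t])`_i
    = \sum_(0 <= i < size s) c i *: s`_i + x * T.
  rewrite size_cat size_map (big_cat_nat (n := size s)) ?leq_addr //=.
  congr (_ + _).
    by apply: eq_big_nat => i /andP[_ lt_is]; rewrite nth_cat lt_is.
  rewrite -{1}(addn0 (size s)) addnC big_addn addKn mulr_sumr.
  apply: eq_big_nat => i /andP[_ lt_it].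
  rewrite nth_cat ltnNge leq_addl addnK (nth_map 0) //= scalerAr.
  by rewrite addnC.
move=> sumP.
have s0 : forall i, (i < size s)%N -> c i = 0.
  apply: s_indep; set S := (X in X + _) in sumP.
  rewrite [X in X \in P'](_ : _ = - T * x + (S + x * T)).
    by apply: P'l => //; apply: PP'.
  by rewrite mulNr mulrC [S + _]addrC addKr.
move: sumP; rewrite big_nat big1 ?add0r; last first.
  by move=> i /andP[_ lt_is]; rewrite s0 // scale0r.
move=> /Pm; rewrite (negPf xP) /= => /t_indep t0 i.
rewrite size_cat size_map => lt_i; have [/s0//|le_si] := ltnP i (size s).
by rewrite -(subnKC le_si); apply: (t0 (i - size s)%N); rewrite ltn_subLR.
Qed.

Lemma msizeM_below (x f : A) C L :
  (msize x <= C.+1)%N -> (msize f <= L)%N -> (msize (x * f) <= C + L)%N.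
Proof.
move=> xC fL; have [->|x0] := eqVneq x 0; first by rewrite mul0r msize0.
have [->|f0] := eqVneq f 0; first by rewrite mulr0 msize0.
by rewrite msizeM // -subn1 leq_subLR addnA add1n leq_add.
Qed.

(* With [x] in [P'] but not in [P], the family [x^i b], [i < D], [b] in [s],
   stays independent one step down the chain. *)
Lemma lin_indep_mod_step P P' s (x : A) C L D :
  is_prime_ideal P -> is_prime_ideal P' -> {subset P <= P'} ->
  x \in P' -> x \notin P -> (msize x <= C.+1)%N ->
  lin_indep_mod P' s -> deg_below L s ->
  exists t, [/\ size t = (D * size s)%N, lin_indep_mod P t
              & deg_below (D * C + L) t].
Proof.
move=> Ppr P'pr PP' xP' xP xC s_indep sL.
elim: D => [|D [t [t_size t_indep tL]]].
  by exists [::]; split.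
exists (s ++ [seq x * b | b <- t]); split.
- by rewrite size_cat size_map t_size mulSn.
- exact: lin_indep_mod_cat s_indep t_indep.
- move=> f; rewrite mem_cat => /orP[/sL fL|/mapP[b /tL bL ->]].
    by apply: leq_trans fL (leq_addl _ _).
  by rewrite mulSn -addnA; apply: msizeM_below.
Qed.

(** Descends from the top prime, where [[:: 1]] is independent; each step multiplies the size by [D]
    and raises the degree bound by [D * C]. *)
Lemma lin_indep_mod_chain d (x : nat -> A) C D :
  forall Q : nat -> {pred A}, (forall i, (i <= d)%N -> is_prime_ideal (Q i)) ->
  (forall i, (i < d)%N ->
     [/\ {subset Q i <= Q i.+1}, x i \in Q i.+1, x i \notin Q i
       & (msize (x i) <= C.+1)%N]) ->
  exists t, [/\ size t = (D ^ d)%N, lin_indep_mod (Q 0%N) t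
              & deg_below (d * (D * C)).+1 t].
Proof.
elim: d x => [|d IH] x Q Qpr Qx.
  exists [:: 1]; split=> // [c|f]; last by rewrite inE => /eqP->; rewrite msize1.
  rewrite /= big_nat1 /= => c1 [|//] _; apply/eqP/negP => /negP c0.
  (* A nonzero constant in a prime ideal would put 1 into it, against properness. *)
  have [[Q0 Q1 Ql] _] := Qpr 0%N isT.
  move: Q1; rewrite (_ : 1 = (c 0%N)^-1%:MP * (c 0%N *: 1) + 0); first by rewrite Ql.
  by rewrite addr0 mul_mpolyC scalerA mulVf // scale1r.
have [|i lt_id|t [t_size t_indep tL]] :=
  IH (fun i => x i.+1) (fun i => Q i.+1).
- by move=> i le_id; apply: Qpr.
- exact: Qx.
have [Q01 x1 x0 xC] := Qx 0%N isT.
have [||u [u_size u_indep uL]] :=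
  lin_indep_mod_step D _ _ Q01 x1 x0 xC t_indep tL; try exact: Qpr.
exists u; split=> //; first by rewrite u_size t_size expnS.
by move=> f /uL; rewrite addnS mulSn.
Qed.

(** A crude count suffices: in total degree below [L] each of the [m] exponents is below [L]. *)
Lemma card_bmultinom_le L : (#|{: 'X_{1..m < L}}| <= L ^ m)%N.
Proof.
case: L => [|L]; first by rewrite eq_card0 // => -[].
have <- : #|{ffun 'I_m -> 'I_L.+1}| = (L.+1 ^ m)%N.
  by rewrite card_ffun !card_ord.
pose F (a : 'X_{1..m < L.+1}) : {ffun 'I_m -> 'I_L.+1} :=
  [ffun i => inord ((a : 'X_{1..m}) i)].
apply: (leq_card F) => a b eqF; apply/val_inj/mnmP => i.
have bnd (c : 'X_{1..m < L.+1}) : (val c i < L.+1)%N.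
  apply: leq_ltn_trans (bmdeg c).
  by rewrite mdegE (bigD1 i) //= leq_addr.
by move/ffunP/(_ i): eqF; rewrite !ffunE => /(congr1 val) /=; rewrite !inordK //; apply: bnd.
Qed.

(** With more polynomials than monomials, the coefficient matrix has a nonzero left kernel, and a
    kernel row is a relation whose value 0 lies in [P]. *)
Lemma size_lin_indep_mod P s L : 0 \in P -> lin_indep_mod P s ->
  deg_below L s -> (size s <= L ^ m)%N.
Proof.
move=> P0 s_indep sL; apply: leq_trans (card_bmultinom_le L).
rewrite leqNgt; apply/negP => lt_card.
pose M := \matrix_(i < size s, j < #|{: 'X_{1..m < L}}|)
  s`_i@_(val (enum_val j)).
have /negP[] : kermx M != 0.
  rewrite -mxrank_eq0 mxrank_ker subn_eq0 -ltnNge.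
  exact: leq_ltn_trans (rank_leq_col _) lt_card.
(* The kernel row [v] is extended by 0 to a coefficient function on [nat]. *)
apply/eqP/row_matrixP => r; apply/rowP => i; rewrite row0 [RHS]mxE.
set v := row r _; pose c j := if insub j is Some j' then v 0 j' else 0.
have -> : v 0 i = c i by rewrite /c valK.
apply: s_indep => //; rewrite big_mkord.
rewrite [X in X \in P](_ : _ = 0) //; apply/mpolyP => a.
rewrite mcoeff0 raddf_sum /=; under eq_bigr do rewrite mcoeffZ.
have [lt_aL|le_La] := ltnP (mdeg a) L; last first.
  rewrite big1 // => j _; rewrite (memN_msupp_eq0 (m := a)) ?mulr0 //.
  by apply: msize_mdeg_ge; apply: leq_trans le_La; apply/sL/mem_nth.
have vM : v *m M = 0 by rewrite -row_mul mulmx_ker row0.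
move/rowP/(_ (enum_rank (BMultinom lt_aL))): vM.
rewrite !mxE => {2}<-; apply: eq_bigr => j _.
by rewrite [M _ _]mxE enum_rankK /= /c valK.
Qed.

Lemma krull_dim_mpoly_le (P : nat -> {pred A}) d : prime_chain P d -> (d <= m)%N.
Proof.
move=> [Ppr Plt]; rewrite leqNgt; apply/negP => lt_md.
have /(@choice _ _ _) [x Px] i : exists f, (i < m.+1)%N ->
    f \in P i.+1 /\ f \notin P i.
  have [lt_im|] := ltnP i m.+1; last by exists 0.
  have [_ nsub] := Plt i (leq_trans lt_im lt_md).
  apply: contrapT => nex; apply: nsub => f fP.
  by apply: contrapT => /negP nfP; apply: nex; exists f.
pose C := (\max_(i < m.+1) msize (x i))%N.
(* [K] makes the degree bound of the family at most [D * K]. Then [D ^ m.+1] independent elements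
   must fit into [(D * K) ^ m] monomials, which fails once [D] exceeds [K ^ m]. *)
pose K := (m.+1 * C).+1; pose D := (K ^ m).+1.
have [|i lt_im|t [t_size t_indep tL]] :=
  @lin_indep_mod_chain m.+1 x C D P.
- by move=> i le_im; apply: Ppr; apply: leq_trans le_im lt_md.
- have [PS _] := Plt i (leq_trans lt_im lt_md).
  have [xS xN] := Px i lt_im; split=> //.
  exact/leqW/(leq_bigmax (Ordinal lt_im)).
have [[[P0 _ _] _] le_t] := (Ppr 0%N isT, @size_lin_indep_mod (P 0%N) t).
have := le_t _ P0 t_indep tL; rewrite t_size leqNgt => /negP[].
apply: (@leq_ltn_trans ((D * K) ^ m)%N).
  have le_DK : ((m.+1 * (D * C)).+1 <= D * K)%N.
    by rewrite mulnCA mulnS addnC -addn1 leq_add2l.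
  by case: (m) le_DK => // m' le_DK; rewrite leq_exp2r.
by rewrite expnMn expnSr ltn_pmul2l ?expn_gt0.
Qed.

Lemma has_krull_dim_mpoly : has_krull_dim {mpoly k[m]} m.
Proof.
split; last exact: krull_dim_mpoly_le.
(* The chain consists of the ideals generated by the first [i] variables, taken as kernels of
   substitutions into a domain, which makes them prime at once. *)
pose kill i : m.-tuple A := [tuple if (j < i)%N then 0 else 'X_j | j < m].
exists (fun i f => f \mPo kill i == 0); split=> i lt_im.
  split; first split.
  - by rewrite unfold_in rmorph0.
  - by rewrite unfold_in rmorph1 oner_eq0.
  - move=> a u v; rewrite !unfold_in => /eqP u0 /eqP v0.
    by rewrite rmorphD rmorphM /= u0 v0 mulr0 addr0.
  - by move=> u v; rewrite !unfold_in rmorphM mulf_eq0.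
have killE l (j : 'I_m) : 'X_j \mPo kill l = if (j < l)%N then 0 else 'X_j.
  by rewrite comp_mpolyXU -tnth_nth tnth_mktuple.
split=> [f|/(_ 'X_(Ordinal lt_im))]; last first.
  rewrite !unfold_in !killE /= ltnSn ltnn eqxx => /(_ isT) /eqP/mpolyP.
  move=> /(_ U_(Ordinal lt_im)%MM)/eqP.
  by rewrite mcoeffXU eqxx mcoeff0 oner_eq0.
rewrite !unfold_in => /eqP f0.
(* Inclusion of kernels: the larger substitution factors through the smaller one. *)
suff -> : f \mPo kill i.+1 = (f \mPo kill i) \mPo kill i.+1.
  by rewrite f0 rmorph0.
rewrite comp_mpolyEX [f \mPo kill i]comp_mpolyEX raddf_sum /=.
apply: eq_bigr => a _.
rewrite !comp_mpolyZ; congr (_ *: _).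
rewrite !comp_mpolyX rmorph_prod; apply: eq_bigr => j _.
rewrite rmorphXn /= !tnth_mktuple; congr (_ ^+ _).
have [lt_ji|le_ij] := ltnP j i; first by rewrite rmorph0 ltnW.
by rewrite killE.
Qed.

End KrullDimPolynomial.

(** * Finitely generated ideals *)

Section IdealGen.
Local Open Scope ring_scope.
Import GRing.Theory.
Variable R : comNzRingType.
Implicit Types (J : {pred R}) (s : seq R).

Lemma mem_ideal_gen s g : g \in s -> g \in ideal_gen s.
Proof.
move=> gs; have lt_gs : (index g s < size s)%N by rewrite index_mem.
apply/asboolP; exists (fun i => (i == Ordinal lt_gs)%:R).
rewrite (bigD1 (Ordinal lt_gs)) //= eqxx mul1r nth_index // big1 ?addr0 //.
by move=> i /negPf->; rewrite mul0r.
Qed.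

Lemma ideal_gen_min J s : ideal_stable J -> {subset s <= J} ->
  {subset ideal_gen s <= J}.
Proof.
move=> Jst sJ f /asboolP[c ->]; apply: ideal_sum => // i _.
by have [_ _ JM] := Jst; apply/JM/sJ/mem_nth.
Qed.

End IdealGen.

(** * Monomial ideals, weights and minimal generators *)

Section MonomialIdeal.
Local Open Scope ring_scope.
Import GRing.Theory.
Variables (k : fieldType) (n : nat).
Local Notation A := {mpoly k[n]}.
Local Notation mono_ideal := (@monomial_ideal_gen k n).
Implicit Types (f g : A) (s : seq 'X_{1..n}) (b m : 'X_{1..n}).

Lemma msupp_mulP f g m : m \in msupp (f * g) ->
  exists m1 m2, [/\ m1 \in msupp f, m2 \in msupp g & m = (m1 + m2)%MM].
Proof.
by move=> /msuppM_le/allpairsP[[m1 m2] /= [m1f m2g ->]]; exists m1, m2.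
Qed.

(** For [Q] closed under adding exponents this is a monomial ideal; membership conditions on
    monomials are then checked on generators only. *)
Definition msupp_all (Q : 'X_{1..n} -> Prop) : {pred A} := fun f =>
  `[< forall m, m \in msupp f -> Q m >].

Lemma msupp_allP Q f :
  reflect (forall m, m \in msupp f -> Q m) (f \in msupp_all Q).
Proof. exact: asboolP. Qed.

Lemma msupp_all_stable (Q : 'X_{1..n} -> Prop) :
  (forall m m', Q m -> Q (m + m')%MM) -> ideal_stable (msupp_all Q).
Proof.
move=> Qup; split.
- by apply/msupp_allP => m; rewrite msupp0.
- move=> f g /msupp_allP fQ /msupp_allP gQ; apply/msupp_allP => m /msuppD_le.
  by rewrite mem_cat => /orP[/fQ|/gQ].
- move=> f g /msupp_allP gQ; apply/msupp_allP => m /msupp_mulP[m1 [m2 [_ m2g ->]]].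
  by rewrite addmC; apply/Qup/gQ.
Qed.

Lemma msupp_sub_ideal (J : {pred A}) f : ideal_stable J ->
  (forall m, m \in msupp f -> 'X_[m] \in J) -> f \in J.
Proof.
move=> Jst fJ; rewrite [f]mpolyE big_seq; apply: ideal_sum => // m mf.
by have [_ _ JM] := Jst; rewrite -mul_mpolyC; apply/JM/fJ.
Qed.

Lemma ideal_mpolyX_le (J : {pred A}) b m : ideal_stable J ->
  (b <= m)%MM -> 'X_[b] \in J -> 'X_[m] \in J.
Proof.
by move=> [_ _ JM] /submK<- bJ; rewrite mpolyXD; apply: JM.
Qed.

Lemma mem_monomial_ideal_gen s f :
  f \in mono_ideal s <->
  forall m, m \in msupp f -> exists2 b, b \in s & (b <= m)%MM.
Proof.
split=> [fs|f_le].
  have upc m m' : (exists2 b, b \in s & (b <= m)%MM) ->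
      exists2 b, b \in s & (b <= m + m')%MM.
    by case=> b bs le_bm; exists b => //; apply: lepm_trans (lem_addr _ _).
  apply/msupp_allP; move: fs; apply: (ideal_gen_min (msupp_all_stable upc)).
  move=> _ /mapP[b bs ->]; apply/msupp_allP => m.
  by rewrite msuppX inE => /eqP ->; exists b; rewrite ?lepm_refl.
have st : ideal_stable (mono_ideal s) by apply: ideal_gen_stable.
apply: msupp_sub_ideal => // m /f_le[b bs le_bm].
by apply: (ideal_mpolyX_le st le_bm); apply/mem_ideal_gen/map_f.
Qed.

Lemma mem_max_ideal f : f \in max_ideal k n <-> f@_0%MM = 0.
Proof.
rewrite [max_ideal k n](_ : _ = mono_ideal [seq U_(i)%MM | i <- enum 'I_n]);
  last by rewrite /monomial_ideal_gen -map_comp.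
split=> [/mem_monomial_ideal_gen fU|f0].
  apply: memN_msupp_eq0; apply/negP => /fU[_ /mapP[i _ ->]].
  by rewrite lep1mP mnm0E eqxx.
apply/mem_monomial_ideal_gen => m mf.
have [i mi|m0] := pickP (fun i => m i != 0%N).
  by exists U_(i)%MM; [apply: map_f; rewrite mem_enum | rewrite lep1mP].
move: mf; rewrite (_ : m = 0%MM) ?mcoeff_msupp ?f0 ?eqxx //.
by apply/mnmP => i; rewrite mnm0E; apply/eqP/negPn; rewrite m0.
Qed.

Section Weight.
Variable a : 'I_n -> nat.
Hypothesis a_gt0 : forall i, (0 < a i)%N.
Definition weight m := (\sum_(i < n) a i * m i)%N.

Lemma weightD m m' : weight (m + m')%MM = (weight m + weight m')%N.
Proof.
by rewrite -big_split; apply: eq_bigr => i _; rewrite mnmDE mulnDr.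
Qed.

Lemma weight_le m m' : (m <= m')%MM -> (weight m <= weight m')%N.
Proof.
by move=> /mnm_lepP le_mm'; apply: leq_sum => i _; rewrite leq_mul2l le_mm' orbT.
Qed.

Lemma weight_gt0 m : (0 < weight m)%N = (m != 0%MM).
Proof.
rewrite lt0n /weight sum_nat_eq0; congr (~~ _).
apply/forallP/eqP => [m0|-> i]; last by rewrite mnm0E muln0.
apply/mnmP => i; rewrite mnm0E; apply/eqP.
by have /implyP/(_ isT) := m0 i; rewrite muln_eq0 eqn0Ngt a_gt0.
Qed.

(** Without its constant term [f] has only monomials of positive weight, so it pushes [g] strictly
    above weight [d]. *)
Lemma mcoeffM_min_weight d f g m :
  (forall m', m' \in msupp g -> (d <= weight m')%N) -> weight m = d ->
  (f * g)@_m = f@_0%MM * g@_m.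
Proof.
move=> g_ge wm; rewrite -{1}[f](subrK (f@_0%MM)%:MP) mulrDl mcoeffD.
rewrite mcoeffCM [X in X + _](_ : _ = 0) ?add0r //.
apply/eqP; rewrite mcoeff_eq0; apply/negP => /msupp_mulP[m1 [m2 [m1f m2g m12]]].
have := g_ge _ m2g; rewrite -wm m12 weightD leqNgt => /negP[].
rewrite -addn1 addnC leq_add2r weight_gt0; apply: contraTneq m1f => ->.
by rewrite -mcoeff_eq0 mcoeffB mcoeffC eqxx mulr1 subrr.
Qed.

(** Graded Nakayama in matrix form: expressing the monomials of [s] through [s'] and comparing
    coefficients in weight [d] factors the identity matrix through dimension [size s']. *)
Lemma min_num_gens_monomial s d : uniq s ->
  (forall b, b \in s -> weight b = d) -> min_num_gens (mono_ideal s) (size s).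
Proof.
move=> s_uniq ws; split=> [|s' ss'].
  by exists [seq 'X_[m] | m <- s]; rewrite ?size_map.
have s'_ge g : g \in s' ->
    forall m', m' \in msupp g -> (d <= weight m')%N.
  move=> /mem_ideal_gen; rewrite -ss' => /mem_monomial_ideal_gen gs m' /gs.
  by move=> [b /ws<-]; apply: weight_le.
have /(@choice _ _ _)[c cE] (i : 'I_(size s)) :
    exists c : 'I_(size s') -> A, 'X_[nth 0%MM s i] = \sum_l c l * s'`_l.
  suff /asboolP : 'X_[nth 0%MM s i] \in ideal_gen s' by [].
  by rewrite -ss'; apply/mem_ideal_gen/map_f/mem_nth.
pose M := \matrix_(i < size s, l < size s') (c i l)@_0%MM.
pose N := \matrix_(l < size s', j < size s) s'`_l@_(nth 0%MM s j).
apply: (@mulmx1_min _ _ _ M N); apply/matrixP => i j; rewrite !mxE.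
transitivity (('X_[nth 0%MM s i] : A)@_(nth 0%MM s j)); last first.
  by rewrite mcoeffX nth_uniq.
rewrite cE raddf_sum /=; apply: eq_bigr => l _; rewrite !mxE.
rewrite (@mcoeffM_min_weight d) ?ws ?mem_nth //.
by apply: s'_ge; apply: mem_nth.
Qed.

Lemma min_monomial_gens_weight s d : uniq s ->
  (forall b, b \in s -> weight b = d) -> min_monomial_gens (mono_ideal s) s.
Proof.
move=> s_uniq ws; split=> // b bs eq_rem.
have [_ /(_ [seq 'X_[m] | m <- rem b s] eq_rem)] :=
  min_num_gens_monomial s_uniq ws.
rewrite size_map size_rem //; case: s bs {s_uniq ws eq_rem} => // c s _.
by rewrite ltnn.
Qed.

End Weight.

End MonomialIdeal.

(** * Ideals of equal-weight monomials with injective exponent map: powers and fiber cone *)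

Section UniformMonomials.
Local Open Scope ring_scope.
Import GRing.Theory.
Variables (k : fieldType) (n t : nat) (u : 'I_t -> 'X_{1..n}).
Local Notation A := {mpoly k[n]}.
Implicit Types (f g : A) (m : 'X_{1..n}) (b : 'X_{1..t}).

Definition exps := [seq u j | j <- enum 'I_t].
(** The exponent map of the substitution of ['X_[u j]] for the [j]-th variable. *)
Definition expo b : 'X_{1..n} := [multinom (\sum_(j < t) b j * u j i)%N | i < n].
Definition degree_multinoms d := [seq s2m s | s : d.-tuple 'I_t <- enum (basis t d)].

Local Notation I := (@monomial_ideal_gen k n exps).

Lemma expoD b c : expo (b + c)%MM = (expo b + expo c)%MM.
Proof.
apply/mnmP => i; rewrite !(mnmE, mnmDE) -big_split.
by apply: eq_bigr => j _; rewrite mnmDE mulnDl.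
Qed.

Lemma expo0 : expo 0%MM = 0%MM.
Proof.
by apply/mnmP => i; rewrite !mnmE big1 // => j _; rewrite mnm0E.
Qed.

Lemma expoU j : expo U_(j)%MM = u j.
Proof.
apply/mnmP => i; rewrite mnmE (bigD1 j) //= mnm1E eqxx mul1n big1 ?addn0 //.
by move=> l nlj; rewrite mnm1E eq_sym (negPf nlj).
Qed.

Lemma mpolyX_expo b : 'X_[expo b] = \prod_(j < t) 'X_[u j] ^+ b j :> A.
Proof.
rewrite mprodXnE; congr 'X_[_]; apply/mnmP => i; rewrite mnmE mnm_sumE.
by apply: eq_bigr => j _; rewrite mulmnE mulnC.
Qed.

Lemma mdegS_split b i : mdeg b = i.+1 ->
  exists j c, mdeg c = i /\ b = (U_(j) + c)%MM.
Proof.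
move=> b_deg; have [j bj|b0] := pickP (fun j => b j != 0%N); last first.
  have bz : b = 0%MM.
    by apply/mnmP => j; rewrite mnm0E; apply/eqP/negPn; rewrite b0.
  by move: b_deg; rewrite bz mdeg0.
have bE : b = (U_(j) + (b - U_(j)))%MM by rewrite addmC submK // lep1mP.
exists j, (b - U_(j))%MM; split=> //.
by move: b_deg; rewrite {1}bE mdegD mdeg1 add1n => -[].
Qed.

Lemma mpolyX_expo_ideal_pow i b : mdeg b = i -> 'X_[expo b] \in ideal_pow I i.
Proof.
elim: i b => [//|i IH] b /mdegS_split[j [c [c_deg ->]]].
rewrite expoD mpolyXD expoU; apply: ideal_mul_in; last exact: IH.
by apply/mem_ideal_gen/map_f/map_f; rewrite mem_enum.
Qed.

Lemma mem_ideal_pow i f : f \in ideal_pow I i <->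
  forall m, m \in msupp f -> exists2 b, mdeg b = i & (expo b <= m)%MM.
Proof.
split=> [fI|f_le]; last first.
  have st := ideal_pow_stable I i; apply: msupp_sub_ideal => // m /f_le[b bi].
  by move=> /(ideal_mpolyX_le st); apply; apply: mpolyX_expo_ideal_pow.
have upc j m m' : (exists2 b, mdeg b = j & (expo b <= m)%MM) ->
    exists2 b, mdeg b = j & (expo b <= m + m')%MM.
  by case=> b bj le_bm; exists b => //; apply: lepm_trans (lem_addr _ _).
elim: i f fI => [f _ m _|i IH f /asboolP[s sP ->]].
  by exists 0%MM; rewrite ?mdeg0 // expo0; apply/mnm_lepP => i; rewrite mnm0E.
apply/msupp_allP; rewrite big_seq.
apply: ideal_sum => [|p /sP[p1I p2I]].
  by apply: msupp_all_stable; apply: upc.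
apply/msupp_allP => m /msupp_mulP[m1 [m2 [m1p m2p ->]]].
have [_ /mapP[j _ ->] le_jm1] := (mem_monomial_ideal_gen _ _).1 p1I _ m1p.
have [b b_deg le_bm2] := IH _ p2I _ m2p.
exists (U_(j) + b)%MM; first by rewrite mdegD mdeg1 b_deg.
rewrite expoD expoU; apply/mnm_lepP => l; rewrite !mnmDE.
by apply: leq_add; [move/mnm_lepP: le_jm1 | move/mnm_lepP: le_bm2]; apply.
Qed.

Lemma ideal_pow_monomial i :
  ideal_pow I i = monomial_ideal_gen (map expo (degree_multinoms i)).
Proof.
apply/funext => f; apply/idP/idP.
  move=> /mem_ideal_pow f_le; apply/mem_monomial_ideal_gen => m.
  move=> /f_le[b /eqP]; rewrite basis_cover => b_deg le_bm.
  by exists (expo b) => //; apply: map_f.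
move=> /mem_monomial_ideal_gen f_le; apply/mem_ideal_pow => m /f_le.
move=> [_ /mapP[b b_deg ->] le_bm]; exists b => //.
by apply/eqP; rewrite basis_cover.
Qed.

(* Each [u j] is the indicator of the complement of [h j] on the image of [h],
   so [b] is recovered from the values [expo b (h l) = mdeg b - b l]. *)
Lemma expo_injective (h : 'I_t -> 'I_n) : (1 < t)%N ->
  (forall j l, u j (h l) = (j != l)) -> injective expo.
Proof.
move=> t_gt1 uh.
have expo_h b l : (expo b (h l) + b l)%N = mdeg b.
  rewrite mnmE mdegE (bigD1 l) //= uh eqxx muln0 add0n [RHS](bigD1 l) //= addnC.
  congr (_ + _)%N; apply: eq_bigr => j njl.
  by rewrite uh njl muln1.
(* Since [t.-1] is positive, this sum recovers [mdeg b] from [expo b]. *)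
have sum_h b : (\sum_(l < t) expo b (h l))%N = (t.-1 * mdeg b)%N.
  apply/eqP; rewrite -(eqn_add2r (mdeg b)) {1}mdegE -big_split /=.
  rewrite -mulSnr prednK ?(ltnW t_gt1) //.
  by under eq_bigr do rewrite expo_h; rewrite sum_nat_const card_ord.
move=> b c eq_bc; have mdeg_bc : mdeg b = mdeg c.
  have t1_gt0 : (0 < t.-1)%N by rewrite -subn1 subn_gt0.
  by apply/eqP; rewrite -(eqn_pmul2l t1_gt0) -!sum_h eq_bc.
apply/mnmP => l; apply/eqP; rewrite -(eqn_add2l (expo b (h l))) expo_h.
by rewrite eq_bc expo_h mdeg_bc.
Qed.

Variables (a : 'I_n -> nat) (d : nat).
Hypothesis a_gt0 : forall i, (0 < a i)%N.
Hypothesis weight_u : forall j, weight a (u j) = d.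
Hypothesis expo_inj : injective expo.

Lemma weight_expo b : weight a (expo b) = (mdeg b * d)%N.
Proof.
have [i bi] : exists i, mdeg b = i by exists (mdeg b).
rewrite bi; elim: i b bi => [b /eqP|i IH b].
  rewrite mdeg_eq0 => /eqP->; rewrite expo0 mul0n /weight.
  by rewrite big1 // => i _; rewrite mnm0E muln0.
move=> /mdegS_split[j [c [c_deg ->]]].
by rewrite expoD expoU weightD weight_u (IH _ c_deg) mulSn.
Qed.

Lemma u_inj : injective u.
Proof.
move=> i j; rewrite -[u i]expoU -[u j]expoU => /expo_inj/eqP.
by rewrite eq_mnm1 => /eqP.
Qed.

Lemma exps_uniq : uniq exps.
Proof. by rewrite map_inj_uniq ?enum_uniq //; apply: u_inj. Qed.

Lemma exps_weight m : m \in exps -> weight a m = d.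
Proof. by move=> /mapP[j _ ->]. Qed.

Lemma quasi_equigenerated_exps : quasi_equigenerated I.
Proof.
exists exps; split.
  exact: (min_monomial_gens_weight k a_gt0 exps_uniq exps_weight).
by exists a; split=> //; exists d; apply: exps_weight.
Qed.

Lemma min_num_gens_exps : min_num_gens I t.
Proof.
have := min_num_gens_monomial k a_gt0 exps_uniq exps_weight.
by rewrite size_map size_enum_ord.
Qed.

Lemma min_num_gens_ideal_pow i : (0 < t)%N ->
  min_num_gens (ideal_pow I i) 'C(i + t.-1, i).
Proof.
move=> t_gt0; rewrite ideal_pow_monomial.
have <- : size (map expo (degree_multinoms i)) = 'C(i + t.-1, i).
  rewrite size_map /degree_multinoms; move: t_gt0.
  by case: (t) => // t' _; apply: size_basis.
apply: (min_num_gens_monomial k a_gt0) => [|_ /mapP[b b_deg ->]].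
  by rewrite map_inj_uniq //; apply: uniq_basis.
rewrite weight_expo.
by move: b_deg; rewrite -basis_cover => /eqP->.
Qed.

(** A monomial of a power [i] weighs at least [i * d], and the factor from the maximal ideal has no
    constant term, hence adds positive weight. *)
Lemma weight_max_ideal_pow i f m :
  f \in ideal_mul (max_ideal k n) (ideal_pow I i) -> m \in msupp f ->
  (i * d < weight a m)%N.
Proof.
have upc m' m'' : (i * d < weight a m')%N -> (i * d < weight a (m' + m'')%MM)%N.
  by rewrite weightD => /leq_trans->//; apply: leq_addr.
move=> /asboolP[s sP ->]; move: m; apply/msupp_allP; rewrite big_seq.
apply: ideal_sum => [|p /sP[/mem_max_ideal p1 p2]].
  exact: msupp_all_stable.
apply/msupp_allP => m /msupp_mulP[m1 [m2 [m1p m2p ->]]]; rewrite weightD.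
have [b b_deg /(weight_le a)] := (mem_ideal_pow _ _).1 p2 _ m2p.
rewrite weight_expo b_deg => le_w; rewrite -add1n leq_add // weight_gt0 //.
by apply: contraTneq m1p => ->; rewrite mcoeff_msupp p1 eqxx.
Qed.

Local Notation rees_maxI := (@rees_max k n I).

Lemma coef_rees (r : rees I) i : (val r)`_i \in ideal_pow I i.
Proof. by have /asboolP := rees_valP r. Qed.

Definition rees_const (c : k) : rees I := Rees (rees_const_subproof I c).

Lemma rees_const_is_zmod_morphism : zmod_morphism rees_const.
Proof.
by move=> x y; apply/val_inj; rewrite rmorphB /= !rmorphB.
Qed.

Lemma rees_const_is_monoid_morphism : monoid_morphism rees_const.
Proof.
split=> [|x y]; apply/val_inj; first by rewrite rmorph1 /= !rmorph1.
by rewrite rmorphM /= !rmorphM.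
Qed.

HB.instance Definition _ :=
  GRing.isZmodMorphism.Build k (rees I) rees_const rees_const_is_zmod_morphism.
HB.instance Definition _ :=
  GRing.isMonoidMorphism.Build k (rees I) rees_const
    rees_const_is_monoid_morphism.

Lemma rees_monomial_subproof i f :
  f \in ideal_pow I i -> f%:P * 'X^i \in rees_pred I.
Proof.
move=> fI; apply/asboolP => j; rewrite coefMXn coefC.
have [j0 _ _] := ideal_pow_stable I j; case: ltngtP => // [lt_ij|->].
  by rewrite subn_eq0 leqNgt lt_ij.
by rewrite subnn eqxx.
Qed.

Lemma exps_ideal_pow1 j : 'X_[u j] \in ideal_pow I 1.
Proof. by rewrite -expoU mpolyX_expo_ideal_pow ?mdeg1. Qed.

Definition rees_gen j : rees I :=
  Rees (rees_monomial_subproof (exps_ideal_pow1 j)).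

(** Sends the [j]-th variable to the degree-one element ['X_[u j] * 'X] of the Rees algebra. *)
Definition rees_of : {mpoly k[t]} -> rees I := mmap rees_const rees_gen.
HB.instance Definition _ := GRing.RMorphism.on rees_of.

Definition fiber_of : {mpoly k[t]} -> fiber_cone I :=
  (\pi_({ideal_quot rees_maxI}))%qT \o rees_of.
HB.instance Definition _ := GRing.RMorphism.on fiber_of.

Lemma fiber_ofC c : fiber_of c%:MP = fiber_const I c.
Proof. by rewrite /fiber_of /= /rees_of mmapC. Qed.

Lemma pi_rees_eq (r r' : rees I) :
  (\pi_({ideal_quot rees_maxI}) r = \pi_({ideal_quot rees_maxI}) r')%qT
  <-> r - r' \in rees_maxI.
Proof. by rewrite Quotient.idealrBE; split=> /eqP. Qed.

Lemma val_rees_of (p : {mpoly k[t]}) : val (rees_of p) =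
  \sum_(b <- msupp p) (p@_b *: 'X_[expo b])%:P * 'X^(mdeg b).
Proof.
rewrite /rees_of /mmap rmorph_sum; apply: eq_bigr => b _.
rewrite rmorphM -mul_mpolyC polyCM -mulrA; congr (_ * _).
rewrite /mmap1 rmorph_prod mpolyX_expo rmorph_prod mdegE -prodrXr -big_split.
by apply: eq_bigr => j _; rewrite rmorphXn /= expr1 exprMn rmorphXn.
Qed.

Lemma mcoeff_rees_of (p : {mpoly k[t]}) b :
  ((val (rees_of p))`_(mdeg b))@_(expo b) = p@_b.
Proof.
rewrite val_rees_of coef_sum raddf_sum [in RHS](mpolyE p) raddf_sum /=.
apply: eq_bigr => c _; rewrite coefMXn coefC mcoeffZ mcoeffX.
case: (eqVneq c b) => [->|ncb]; first by rewrite ltnn subnn mcoeffZ mcoeffX eqxx.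
rewrite mulr0; case: ltnP => // _; first by rewrite mcoeff0.
case: eqP => _; last by rewrite mcoeff0.
by rewrite mcoeffZ mcoeffX (inj_eq expo_inj) (negPf ncb) mulr0.
Qed.

(** The coefficient of [p - q] at [b] reappears in Rees degree [mdeg b] at the monomial [expo b], of
    weight exactly [mdeg b * d]; elements of [rees_max] have only heavier monomials there. *)
Lemma fiber_of_inj : injective fiber_of.
Proof.
move=> p q /pi_rees_eq; rewrite -rmorphB => /asboolP pq0.
apply/eqP; rewrite -subr_eq0; apply/eqP/mpolyP => b.
rewrite mcoeff0 -mcoeff_rees_of; apply: memN_msupp_eq0; apply/negP.
move=> /(weight_max_ideal_pow (pq0 _)).
by rewrite weight_expo ltnn.
Qed.

(** Stated on plain polynomials, so that an element can be split into sums and products while the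
    witness [r] carries membership in the Rees algebra. *)
Definition fiber_range (q : {poly A}) : Prop := exists2 r : rees I, val r = q &
  exists p, fiber_of p = (\pi_({ideal_quot rees_maxI}) r)%qT.

Lemma fiber_rangeD q q' :
  fiber_range q -> fiber_range q' -> fiber_range (q + q').
Proof.
move=> [r <- [p pE]] [r' <- [p' p'E]]; exists (r + r'); first exact: rmorphD.
by exists (p + p'); rewrite !rmorphD /= pE p'E.
Qed.

Lemma fiber_rangeM q q' :
  fiber_range q -> fiber_range q' -> fiber_range (q * q').
Proof.
move=> [r <- [p pE]] [r' <- [p' p'E]]; exists (r * r'); first exact: rmorphM.
by exists (p * p'); rewrite !rmorphM /= pE p'E.
Qed.

Lemma fiber_range_sum (T : eqType) (s : seq T) (F : T -> {poly A}) :
  (forall i, i \in s -> fiber_range (F i)) -> fiber_range (\sum_(i <- s) F i).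
Proof.
move=> sF; rewrite big_seq; elim/big_ind: _ => //; last exact: fiber_rangeD.
by exists 0; rewrite ?rmorph0 //; exists 0; rewrite !rmorph0.
Qed.

Lemma fiber_rangeC f : fiber_range f%:P.
Proof.
have fI : f%:P * 'X^0 \in rees_pred I by apply: rees_monomial_subproof.
exists (Rees fI); first by rewrite /= mulr1.
(* In Rees degree 0, [f] is congruent to its constant term modulo the maximal ideal. *)
exists (f@_0%MM)%:MP; rewrite fiber_ofC; apply/pi_rees_eq/asboolP => i.
rewrite rmorphB /= mulr1 -polyCB coefC; case: eqP => [->|_].
  rewrite -[X in X \in _]mulr1; apply: ideal_mul_in => //.
  by apply/mem_max_ideal; rewrite mcoeffB mcoeffC eqxx mulr1 subrr.
have [] // := @ideal_mul_stable _ (max_ideal k n) (ideal_pow I i).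
by have [] := ideal_pow_stable I i.
Qed.

Lemma fiber_range_gens f : f \in I -> fiber_range (f%:P * 'X).
Proof.
move=> /asboolP[c ->]; rewrite rmorph_sum mulr_suml.
apply: fiber_range_sum => i _; rewrite rmorphM -mulrA.
apply: fiber_rangeM; first exact: fiber_rangeC.
have /mapP[_ /mapP[j _ ->] ->] :
  [seq 'X_[m] | m <- exps]`_i \in [seq ('X_[m] : A) | m <- exps].
  by rewrite mem_nth.
exists (rees_gen j); first by rewrite /= expr1.
by exists 'X_j; rewrite /fiber_of /= /rees_of mmapX mmap1U.
Qed.

Lemma fiber_range_ideal_pow i f :
  f \in ideal_pow I i -> fiber_range (f%:P * 'X^i).
Proof.
elim: i f => [f _|i IH f /asboolP[s sP ->]].
  by rewrite mulr1; apply: fiber_rangeC.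
rewrite rmorph_sum mulr_suml; apply: fiber_range_sum => p /sP[p1 p2].
rewrite rmorphM exprS mulrACA.
by apply: fiber_rangeM; [apply: fiber_range_gens | apply: IH].
Qed.

Lemma fiber_of_surj x : exists p, fiber_of p = x.
Proof.
suff [r rE [p pE]] : fiber_range (val (repr x)).
  by exists p; rewrite pE (val_inj rE) reprK.
rewrite -[val _]coefK poly_def.
apply: fiber_range_sum => i _; rewrite -mul_polyC.
exact/fiber_range_ideal_pow/coef_rees.
Qed.

Lemma fiber_of_bij : bijective fiber_of.
Proof.
have [g gK] := choice fiber_of_surj.
by exists g => // p; apply: fiber_of_inj; rewrite gK.
Qed.

Lemma linear_type_exps : linear_type I.
Proof.
exists t; first exact: min_num_gens_exps.
by exists fiber_of; [apply: fiber_of_bij | apply: fiber_ofC].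
Qed.

Lemma freiman_exps : (0 < t)%N -> freiman I.
Proof.
move=> t_gt0; split; first exact: quasi_equigenerated_exps.
exists t, t, 'C(2 + t.-1, 2); split.
- exact: has_krull_dim_iso fiber_of_bij (has_krull_dim_mpoly k t).
- exact: min_num_gens_exps.
- exact: min_num_gens_ideal_pow.
(* By Pascal's rule ['C(t.+1, 2)] is ['C(t, 2) + t], which leaves [t * t = 2 * 'C(t, 2) + t]. *)
rewrite add2n prednK // binS bin1 PoszD.
suff -> : t%:Z * t%:Z = 'C(t, 2)%:Z + 'C(t, 2)%:Z + t%:Z.
  by rewrite addrAC addrK.
rewrite -PoszM -!PoszD; congr Posz; rewrite addnn -mul2n -mul_bin_diag bin1.
by rewrite -mulnSr prednK.
Qed.

End UniformMonomials.

(** * Cover ideals through vertex covers *)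

Section CoverIdeal.
Local Open Scope ring_scope.
Import GRing.Theory.
Variables (k : fieldType) (n : nat) (e : rel 'I_n).
Implicit Type m : 'X_{1..n}.

Definition vertex_cover m := forall i j, e i j -> (m i != 0%N) || (m j != 0%N).

Lemma mem_cover_ideal (f : {mpoly k[n]}) :
  f \in cover_ideal k e <-> forall m, m \in msupp f -> vertex_cover m.
Proof.
have gen2P i j : f \in ideal_gen [:: 'X_i; 'X_j] <->
    forall m, m \in msupp f -> (m i != 0%N) || (m j != 0%N).
  have /= := mem_monomial_ideal_gen [:: U_(i)%MM; U_(j)%MM] f.
  move=> [fij f_le]; split=> [/fij{}f_le m /f_le[b]|f_cov].
    by rewrite !inE => /orP[]/eqP->; rewrite lep1mP => ->; rewrite ?orbT.
  apply: f_le => m /f_cov/orP[]mi.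
    by exists U_(i)%MM; rewrite ?inE ?eqxx ?lep1mP.
  by exists U_(j)%MM; rewrite ?inE ?eqxx ?orbT ?lep1mP.
split=> [fe m mf i j eij|f_cov].
  move/forallP/(_ i)/forallP/(_ j)/implyP/(_ eij): fe => /gen2P; exact.
apply/forallP => i; apply/forallP => j; apply/implyP => eij.
by apply/gen2P => m /f_cov; apply.
Qed.

(** Reduces the theorem to combinatorial data: generating covers [u], weights [a] equalizing them,
    and vertices [h] at which the covers are told apart. *)
Lemma cover_ideal_freiman_linear (t : nat) (u : 'I_t -> 'X_{1..n}) (a : 'I_n -> nat)
    (d : nat) (h : 'I_t -> 'I_n) :
  (1 < t)%N -> (forall j l, u j (h l) = (j != l)) ->
  (forall i, 0 < a i)%N -> (forall j, weight a (u j) = d) ->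
  (forall m, vertex_cover m <-> exists j, (u j <= m)%MM) ->
  [/\ quasi_equigenerated (cover_ideal k e), freiman (cover_ideal k e)
    & linear_type (cover_ideal k e)].
Proof.
move=> t_gt1 uh a_gt0 wu cov_u.
have -> : cover_ideal k e = monomial_ideal_gen (exps u).
  apply/funext => f; apply/idP/idP.
    move=> /mem_cover_ideal f_cov; apply/mem_monomial_ideal_gen => m.
    move=> /f_cov/cov_u[j le_jm]; exists (u j) => //.
    by rewrite map_f ?mem_enum.
  move=> /mem_monomial_ideal_gen f_le; apply/mem_cover_ideal => m /f_le.
  by move=> [_ /mapP[j _ ->] le_jm]; apply/cov_u; exists j.
have u_inj := expo_injective t_gt1 uh; split.
- exact: quasi_equigenerated_exps a_gt0 wu u_inj.
- exact: freiman_exps a_gt0 wu u_inj (ltnW t_gt1).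
- exact: linear_type_exps a_gt0 wu u_inj.
Qed.

End CoverIdeal.

(** * Almost complete graphs and the complete case *)

Section AlmostComplete.
Variables (k : fieldType) (n : nat).

Lemma almost_completeP (e : rel 'I_n) : almost_complete e -> 0 < n ->
  exists v, forall x y, x != v -> y != v -> x != y -> e x y.
Proof.
move=> [S cardS Se] n_gt0; have /cards1P[v Sv] : #|~: S| == 1.
  by rewrite -(eqn_add2l #|S|) cardsC cardS card_ord addn1 prednK.
have inS x : (x \in S) = (x != v) by rewrite -[S]setCK Sv !inE.
by exists v => x y xv yv; apply: Se; rewrite inS.
Qed.

Definition complement_multinom (j : 'I_n) : 'X_{1..n} :=
  [multinom nat_of_bool (i != j) | i < n].

Lemma cover_ideal_complete (e : rel 'I_n) : (forall i j, e i j = (i != j)) ->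
  1 < n ->
  [/\ quasi_equigenerated (cover_ideal k e), freiman (cover_ideal k e)
    & linear_type (cover_ideal k e)].
Proof.
move=> eE n_gt1.
apply: (@cover_ideal_freiman_linear k n e n complement_multinom (fun=> 1) n.-1 id) => //.
- by move=> j l; rewrite mnmE eq_sym.
- move=> j; rewrite /weight (bigD1 j) //= mnmE eqxx muln0 add0n.
  under eq_bigr => i nij do rewrite mul1n mnmE nij.
  by rewrite sum1_card cardC1 card_ord.
move=> m; split=> [m_cov|[j /mnm_lepP le_jm] i l].
  have [j mj|m_pos] := pickP (fun j => m j == 0).
    exists j; apply/mnm_lepP => i; rewrite mnmE; case: eqVneq => // nij.
    by have := m_cov i j; rewrite eE nij mj orbF lt0n; apply.
  (* With full support every generator divides; vertex 0 is an arbitrary choice. *)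
  exists (Ordinal (ltnW n_gt1)); apply/mnm_lepP => i.
  by rewrite mnmE (leq_trans (leq_b1 _)) // lt0n m_pos.
rewrite eE => nil; have := le_jm i; rewrite mnmE -!lt0n.
case: eqVneq => [eij _|_ ->//]; have := le_jm l.
by rewrite mnmE -eij eq_sym nil => ->; rewrite orbT.
Qed.

End AlmostComplete.

(** * The case where [v] has a non-neighbour *)

Section OneDeficientVertex.
Variables (k : fieldType) (n : nat) (e : rel 'I_n.+1) (v : 'I_n.+1).

(** [lift v] enumerates the vertices other than [v]; the cover omits [lift v j], and contains [v]
    only if that vertex is its neighbour. *)
Definition deficient_multinom (j : 'I_n) : 'X_{1..n.+1} :=
  [multinom (if i == v then e v (lift v j) : nat else i != lift v j) | i < n.+1].

Lemma cover_ideal_deficient (y : 'I_n.+1) : simple_graph e ->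
  (forall x y, x != v -> y != v -> x != y -> e x y) ->
  y != v -> ~~ e v y -> 1 < n ->
  [/\ quasi_equigenerated (cover_ideal k e), freiman (cover_ideal k e)
    & linear_type (cover_ideal k e)].
Proof.
move=> [e_sym e_irr] clique yv nevy n_gt1.
(* Omitting [x] saves [e v x + 1], while [v], of weight 1 as [e v v] is false, costs [e v x]: the
   total is one less than the full sum, whatever [x] is. *)
pose a i := (e v i).+1.
have lift_neqv j : lift v j == v = false by rewrite eq_sym (negPf (neq_lift v j)).
apply: (@cover_ideal_freiman_linear k _ e n deficient_multinom a
  (\sum_(i | i != v) a i).-1 (lift v)) => //.
- by move=> j l; rewrite mnmE lift_neqv (inj_eq lift_inj) eq_sym.
- move=> j; set x := lift v j; have xv : x != v by rewrite /x lift_neqv.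
  rewrite /weight (bigD1 v) //= mnmE eqxx /a e_irr mul1n -/x.
  rewrite [in RHS](bigD1 x) //=; congr (_ + _).
  rewrite (bigD1 x) //= mnmE (negPf xv) -/x eqxx muln0 add0n.
  apply: eq_bigr => i /andP[iv ix].
  by rewrite mnmE (negPf iv) -/x ix muln1.
move=> m; split=> [m_cov|[j /mnm_lepP le_jm] i l eil].
  have [x /andP[xv mx]|m_pos] := pickP (fun x => (x != v) && (m x == 0)).
    have [j xE|xE] := unliftP v x; last by rewrite xE eqxx in xv.
    exists j; apply/mnm_lepP => i; rewrite mnmE -xE; case: eqVneq => [->|iv].
      case evx: (e v x) => //.
      by have := m_cov _ _ evx; rewrite mx orbF lt0n.
    case: eqVneq => // ix; have := m_cov _ _ (clique _ _ iv xv ix).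
    by rewrite mx orbF lt0n.
  (* If [m] misses at most [v], the generator omitting the non-neighbour [y] divides it, having
     exponent 0 at [v]. *)
  have [j yE|yE] := unliftP v y; last by rewrite yE eqxx in yv.
  exists j; apply/mnm_lepP => i; rewrite mnmE -yE; case: eqVneq => [->|iv].
    by rewrite (negPf nevy).
  by rewrite (leq_trans (leq_b1 _)) // lt0n; have := m_pos i; rewrite iv /= => ->.
(* Conversely only [v] and [x] can be missing, and an edge between them forces [v] into the
   support. *)
set x := lift v j in le_jm.
have m_pos z : z != v -> z != x -> m z != 0.
  by move=> zv zx; have := le_jm z; rewrite mnmE (negPf zv) -/x zx lt0n.
have mv : e v x -> m v != 0.
  by move=> evx; have := le_jm v; rewrite mnmE eqxx -/x evx lt0n.
have nil : i != l by apply: contraTneq eil => ->; rewrite e_irr.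
have [iv|iv] := eqVneq i v; have [lx|lx] := eqVneq l x.
- by move: eil; rewrite iv lx => /mv->.
- by rewrite [m l != 0]m_pos ?orbT // -iv eq_sym.
- by rewrite m_pos // -lx.
have [ix|ix] := eqVneq i x; last by rewrite m_pos.
have [lv|lv] := eqVneq l v; last by rewrite [m l != 0]m_pos ?orbT.
by move: eil; rewrite ix lv e_sym => /mv->; rewrite orbT.
Qed.

End OneDeficientVertex.

Theorem theorem4p10 (k : fieldType) (n : nat) (e : rel 'I_n) :
  simple_graph e -> almost_complete e -> 4 <= n ->
  [/\ quasi_equigenerated (cover_ideal k e),
      freiman (cover_ideal k e)
    & linear_type (cover_ideal k e)].
Proof.
move=> e_simple e_ac n_ge4; have [e_sym e_irr] := e_simple.
have [v clique] := almost_completeP e_ac (ltnW (ltnW (ltnW n_ge4))).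
(* If [v] is adjacent to all other vertices, the graph is complete. *)
have [y /andP[yv nevy]|v_full] := pickP (fun y => (y != v) && ~~ e v y).
  case: n e e_simple {e_sym e_irr e_ac} n_ge4 v y clique yv nevy => // n e e_simple.
  move=> n_ge4 v y clique yv nevy.
  by apply: (@cover_ideal_deficient k n e v y) => //; apply: ltnW.
apply: cover_ideal_complete (ltnW (ltnW n_ge4)) => i j.
have vE z : z != v -> e v z.
  by move=> zv; have := v_full z; rewrite zv => /negbFE.
have [->|nij] := eqVneq i j; first exact: e_irr.
have [iv|iv] := eqVneq i v; first by rewrite iv vE // eq_sym -iv.
have [jv|jv] := eqVneq j v; first by rewrite e_sym jv vE.
exact: clique.
Qed.
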